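(* Let $X$ be a finite biquandle, $R$ a commutative ring with identity, and $(A,B)$ a biquandle bracket on $X$ over $R$. Let $x,y,z\in X$. (1) Consider the moves which carry a strand over a trace of type $A$ (for either sign of the trace and either direction of the moving strand), with colors $(x,y,z)$ as specified in the context. The bracket is compatible with such a move if and only if $$A_{x,y}=A_{x^z,y^z}\quad\text{and}\quad A_{y,z}B_{x^y,z_y}=B_{x,z}A_{y_x,z_x}=A_{x,z}B_{y_x,z_x}=B_{y,z}A_{x^y,z_y}.$$ The necessary and sufficient conditions for the moves which carry a strand over a trace of type $B$, with colors $(x,y,z)$, are exactly the same. (2) Consider the moves which carry a strand under a trace of type $A$ (for either sign of the trace and either direction of the moving strand), with colors $(x,y,z)$ as specified in the context. The bracket is compatible with such a move if and only if $$A_{y,z}=A_{y_x,z_x}\quad\text{and}\quad A_{x,y}B_{x^y,z_y}=B_{x,z}A_{x^z,y^z}=A_{x,z}B_{x^z,y^z}=B_{x,y}A_{x^y,z_y}.$$ The necessary and sufficient conditions for the moves which carry a strand under a trace of type $B$, with colors $(x,y,z)$, are exactly the same.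
   Context: **Biquandles.** A biquandle is a set $X$ with operations $(x,y)\mapsto x^y$ and $(x,y)\mapsto x_y$ such that for all $x,y,z\in X$: (i) $x^x=x_x$; (ii) the maps $\alpha_x(y)=y_x$, $\beta_x(y)=y^x$ on $X$ and $S(x,y)=(y_x,x^y)$ on $X\times X$ are invertible; (iii) $(x^y)^{(z^y)}=(x^z)^{(y_z)}$, $(x^y)_{(z^y)}=(x_z)^{(y_z)}$, $(x_y)_{(z_y)}=(x_z)_{(y^z)}$. **Biquandle brackets.** A biquandle bracket on $X$ over a commutative ring $R$ with identity is a pair of maps $A,B:X\times X\to R^\times$, $(x,y)\mapsto A_{x,y},B_{x,y}$, such that: (i) the element $-A_{x,x}^2B_{x,x}^{-1}$ is the same for all $x\in X$, denoted $w$; (ii) the element $-A_{x,y}^{-1}B_{x,y}-A_{x,y}B_{x,y}^{-1}$ is the same for all $x,y\in X$, denoted $\delta$; (iii) for all $x,y,z\in X$: $$A_{x,y}A_{y,z}A_{x^y,z_y}=A_{x,z}A_{y_x,z_x}A_{x^z,y^z},$$ $$A_{x,y}B_{y,z}B_{x^y,z_y}=B_{x,z}B_{y_x,z_x}A_{x^z,y^z},$$ $$B_{x,y}A_{y,z}B_{x^y,z_y}=B_{x,z}A_{y_x,z_x}B_{x^z,y^z},$$ $$A_{x,y}A_{y,z}B_{x^y,z_y}=A_{x,z}B_{y_x,z_x}A_{x^z,y^z}+A_{x,z}A_{y_x,z_x}B_{x^z,y^z}+\delta A_{x,z}B_{y_x,z_x}B_{x^z,y^z}+B_{x,z}B_{y_x,z_x}B_{x^z,y^z},$$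 $$B_{x,y}A_{y,z}A_{x^y,z_y}+A_{x,y}B_{y,z}A_{x^y,z_y}+\delta B_{x,y}B_{y,z}A_{x^y,z_y}+B_{x,y}B_{y,z}B_{x^y,z_y}=B_{x,z}A_{y_x,z_x}A_{x^z,y^z}.$$ **Colorings.** An $X$-coloring of an oriented link (or tangle) diagram assigns an element of $X$ to each semiarc (edge between consecutive crossing points) so that at each crossing, rotated so that both strands point upward, if the left-hand edge of the under-strand has color $a$ and the left-hand edge of the over-strand has color $b$, then the right-hand edge of the under-strand has color $a^b$ and the right-hand edge of the over-strand has color $b_a$. Such a crossing is said to have colors $(a,b)$. (In this position a crossing is positive when the over-strand runs from lower left to upper right.) **Trace diagrams.** A trace diagram is obtained from an oriented diagram by smoothing some of its crossings, recording each smoothing by a dashed edge (a trace) joining the two resulting arcs and labeled with the sign $+$ or $-$ of the smoothed crossing. The trace has type $A$ if the smoothing is the oriented one (two parallel oriented strands), and type $B$ if it is the other one (the two incoming edges meet at a bivalent sink, the two outgoing edges leave a bivalent source). An $X$-coloring of a trace diagram is an assignment of elements of $X$ to the directed edges which is an $X$-coloring when every trace is replaced by a crossing of the same sign; a trace has colors $(a,b)$ if that crossing does. **Skein expansion.** A positive crossing with colors $(a,b)$ expands as $A_{a,b}$ times the diagram with that crossing replaced by a $+$ trace of type $A$, plus $B_{a,b}$ times the diagram with it replaced by a $+$ trace of type $B$. A negative crossing with colors $(a,b)$ expands as $A_{a,b}^{-1}$ times the diagram with a $-$ trace of type $A$, plus $B_{a,b}^{-1}$ times the diagram with a $-$ trace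 of type $B$. **Trace moves.** Take an oriented Reidemeister III move on three strands all oriented upward, i.e. a replacement of a braid-like diagram of shape $s_1s_2s_1$ by one of shape $s_2s_1s_2$ or vice versa ($s_i$ denotes a crossing, of either sign, between positions $i$ and $i+1$ from the left), in which one strand $S$, the moving strand, passes over both other strands (overcrossing move) or under both other strands (undercrossing move). On both sides of the move replace the crossing of the two strands other than $S$ by a trace of that crossing's sign and of a fixed type ($A$ or $B$). The sign of the trace ($\pm$) and the direction of $S$ (left-to-right or right-to-left) give four moves for each choice of type and of over/under, hence 16 moves. The sides are $X$-colored with the same colors on the boundary. Colors $(x,y,z)$: on the side of shape $s_1s_2s_1$ (where the trace lies on the left), in an overcrossing move the trace has colors $(x,y)$ and the leftmost edge of $S$ has color $z$; in an undercrossing move the trace has colors $(y,z)$ and the leftmost edge of $S$ has color $x$. **Compatibility.** Expand both crossings on each side by the skein expansion, delete traces, replace each closed loop inside the neighborhood of the move by a factor $\delta$, and collect the total coefficient of each boundary connectivity (the way the boundary points of the neighborhood are joined inside). The bracket is compatible with the move (for the given colors) if for every boundary connectivity the total coefficients from the two sides are equal. (The signs of the traces and crossings are the same on both sides, so writhe factors agree.) *)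

(* Defs.v *)
From HB Require Import structures.
From mathcomp Require Import all_boot all_algebra.

Set Implicit Arguments.
Unset Strict Implicit.
Unset Printing Implicit Defensive.

Import GRing.Theory.
Local Open Scope ring_scope.

(* [up x y] is x^y and [dn x y] is x_y. *)
Record biquandle (X : Type) := Biquandle {
  up : X -> X -> X;
  dn : X -> X -> X;
  up_dn_diag : forall x, up x x = dn x x;
  alpha_bij : forall x, bijective (fun y => dn y x);
  beta_bij : forall x, bijective (fun y => up y x);
  S_bij : bijective (fun p : X * X => (dn p.2 p.1, up p.1 p.2));
  up_up : forall x y z, up (up x y) (up z y) = up (up x z) (dn y z);
  dn_up : forall x y z, dn (up x y) (up z y) = up (dn x z) (dn y z);
  dn_dn : forall x y z, dn (dn x y) (dn z y) = dn (dn x z) (up y z)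
}.

(* R is an arbitrary commutative ring: the zero ring is allowed and
   invertibility need not be decidable, hence comPzRingType rather than
   comUnitRingType.  Elements of R^x are given with their inverses, which they
   determine: [brAV] and [brBV] are the inverses of the values of [brA], [brB]. *)
Record bracket (X : Type) (Q : biquandle X) (R : comPzRingType) := Bracket {
  brA : X -> X -> R;
  brB : X -> X -> R;
  brAV : X -> X -> R;
  brBV : X -> X -> R;
  brA_unit : forall x y, brA x y * brAV x y = 1;
  brB_unit : forall x y, brB x y * brBV x y = 1;
  brw : R;
  brdelta : R;
  bracket_w : forall x, - (brA x x ^+ 2 * brBV x x) = brw;
  bracket_delta : forall x y,
    - (brAV x y * brB x y) - brA x y * brBV x y = brdelta;
  bracket_AAA : forall x y z,
    brA x y * brA y z * brA (up Q x y) (dn Q z y) =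
    brA x z * brA (dn Q y x) (dn Q z x) * brA (up Q x z) (up Q y z);
  bracket_ABB : forall x y z,
    brA x y * brB y z * brB (up Q x y) (dn Q z y) =
    brB x z * brB (dn Q y x) (dn Q z x) * brA (up Q x z) (up Q y z);
  bracket_BAB : forall x y z,
    brB x y * brA y z * brB (up Q x y) (dn Q z y) =
    brB x z * brA (dn Q y x) (dn Q z x) * brB (up Q x z) (up Q y z);
  bracket_AAB : forall x y z,
    brA x y * brA y z * brB (up Q x y) (dn Q z y) =
    brA x z * brB (dn Q y x) (dn Q z x) * brA (up Q x z) (up Q y z)
    + brA x z * brA (dn Q y x) (dn Q z x) * brB (up Q x z) (up Q y z)
    + brdelta * brA x z * brB (dn Q y x) (dn Q z x) * brB (up Q x z) (up Q y z)
    + brB x z * brB (dn Q y x) (dn Q z x) * brB (up Q x z) (up Q y z);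
  bracket_BAA : forall x y z,
    brB x y * brA y z * brA (up Q x y) (dn Q z y)
    + brA x y * brB y z * brA (up Q x y) (dn Q z y)
    + brdelta * brB x y * brB y z * brA (up Q x y) (dn Q z y)
    + brB x y * brB y z * brB (up Q x y) (dn Q z y) =
    brB x z * brA (dn Q y x) (dn Q z x) * brA (up Q x z) (up Q y z)
}.

Inductive crossing_sign := Pos | Neg.

(* [TypeA] is the oriented smoothing, [TypeB] the other one. *)
Inductive smoothing := TypeA | TypeB.

Definition smoothing_to_bool t := if t is TypeA then true else false.
Definition smoothing_of_bool (b : bool) := if b then TypeA else TypeB.
Lemma smoothing_to_boolK : cancel smoothing_to_bool smoothing_of_bool.
Proof. by case. Qed.
HB.instance Definition _ := Finite.copy smoothing (can_type smoothing_to_boolK).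

(* A braid-like trace diagram on n.+1 upward strands is read from bottom to
   top: site l : 'I_m lies between the levels [lo l] and [hi l] of 'I_m.+1 and
   involves the positions [lo i] and [hi i] of 'I_n.+1, counted from the left,
   where i is its [site_pos].  It is a crossing when [site_trace] is [None], and
   a trace of type t (and sign [site_sign]) when [site_trace] is [Some t]. *)
Record site (n : nat) := Site {
  site_pos : 'I_n;
  site_sign : crossing_sign;
  site_trace : option smoothing
}.

Definition diagram (m n : nat) := m.-tuple (site n).

Definition lo (k : nat) (i : 'I_k) : 'I_k.+1 := widen_ord (leqnSn k) i.
Definition hi (k : nat) (i : 'I_k) : 'I_k.+1 := lift ord0 i.

Section Colorings.

Variables (X : Type) (Q : biquandle X) (m n : nat).
Variable D : diagram m n.

(* [c l j] is the color of the edge through the point at level l and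
   position j; an edge which avoids a site passes through several such points. *)
Variable c : 'I_m.+1 -> 'I_n.+1 -> X.

Section AtSite.
Variable l : 'I_m.
Let i := site_pos (tnth D l).

(* At a positive crossing the over-strand runs from lower left to upper right,
   at a negative one from lower right to upper left. *)
Definition under_left :=
  if site_sign (tnth D l) is Pos then c (hi l) (lo i) else c (lo l) (lo i).
Definition over_left :=
  if site_sign (tnth D l) is Pos then c (lo l) (lo i) else c (hi l) (lo i).
Definition under_right :=
  if site_sign (tnth D l) is Pos then c (lo l) (hi i) else c (hi l) (hi i).
Definition over_right :=
  if site_sign (tnth D l) is Pos then c (hi l) (hi i) else c (lo l) (hi i).

Definition site_colors : X * X := (under_left, over_left).

Definition site_colored : Prop :=
  [/\ under_right = up Q under_left over_left,
      over_right = dn Q over_left under_left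
    & forall j, j != lo i -> j != hi i -> c (lo l) j = c (hi l) j].

End AtSite.

Definition coloring : Prop := forall l, site_colored l.

End Colorings.

Section Skein.

Variables (X : Type) (Q : biquandle X) (R : comPzRingType) (K : bracket Q R).
Variables (m n : nat) (D : diagram m n).

Definition point := ('I_m.+1 * 'I_n.+1)%type.

(* A state chooses a smoothing at every site. *)
Definition state := {ffun 'I_m -> smoothing}.

(* The smoothings of the traces are prescribed. *)
Definition expands (s : state) : bool :=
  [forall l, if site_trace (tnth D l) is Some t then s l == t else true].

(* The arcs of the state s drawn between the levels [lo l] and [hi l]. *)
Definition vertical_arc (s : state) (l : 'I_m) (u v : point) : bool :=
  let i := site_pos (tnth D l) in
  [&& u.1 == lo l, v.1 == hi l, u.2 == v.2
    & (s l == TypeA) || ((u.2 != lo i) && (u.2 != hi i))].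

Definition turning_arc (s : state) (l : 'I_m) (u v : point) : bool :=
  let i := site_pos (tnth D l) in
  [&& s l == TypeB, u.2 == lo i, v.2 == hi i, u.1 == v.1
    & (u.1 == lo l) || (u.1 == hi l)].

Definition joined (s : state) : rel point := fun u v =>
  [exists l, [|| vertical_arc s l u v, vertical_arc s l v u,
                 turning_arc s l u v | turning_arc s l v u]].

(* (false, j) is the bottom endpoint at position j, (true, j) the top one. *)
Definition endpoint := (bool * 'I_n.+1)%type.
Definition endpoint_point (e : endpoint) : point :=
  (if e.1 then ord_max else ord0, e.2).

(* The pairs of endpoints which lie on the same arc. *)
Definition connectivity (s : state) : {set endpoint * endpoint} :=
  [set p | connect (joined s) (endpoint_point p.1) (endpoint_point p.2)].

(* The closed loops are the components without endpoints. *)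
Definition loops (s : state) : nat :=
  n_comp (joined s)
    [pred v | [forall e, ~~ connect (joined s) (endpoint_point e) v]].

Variable c : 'I_m.+1 -> 'I_n.+1 -> X.

Definition skein_weight (l : 'I_m) (t : smoothing) : R :=
  if site_trace (tnth D l) is Some _ then 1 else
  let: (a, b) := site_colors D c l in
  match site_sign (tnth D l), t with
  | Pos, TypeA => brA K a b
  | Pos, TypeB => brB K a b
  | Neg, TypeA => brAV K a b
  | Neg, TypeB => brBV K a b
  end.

Definition total_coef (kappa : {set endpoint * endpoint}) : R :=
  \sum_(s : state | expands s && (connectivity s == kappa))
    (\prod_l skein_weight l (s l)) * brdelta K ^+ loops s.

End Skein.

Inductive passage := Over | Under.
Inductive direction := LeftToRight | RightToLeft.

Record move := Move {
  move_passage : passage;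
  move_type : smoothing;
  move_sign : crossing_sign;
  move_dir : direction
}.

(* The sign of the two crossings on the moving strand S. *)
Definition moving_sign (p : passage) (d : direction) : crossing_sign :=
  match p, d with
  | Over, LeftToRight | Under, RightToLeft => Pos
  | Over, RightToLeft | Under, LeftToRight => Neg
  end.

Section Moves.

Variable M : move.

Let trace_at (i : 'I_2) : site 2 :=
  Site i (move_sign M) (Some (move_type M)).
Let cross_at (i : 'I_2) : site 2 :=
  Site i (moving_sign (move_passage M) (move_dir M)) None.
Let s1 : 'I_2 := ord0.
Let s2 : 'I_2 := ord_max.

(* The side of shape s1 s2 s1.  If S runs from left to right it starts at the
   bottom left, so that the other two strands meet at the top; if it runs from
   right to left they meet at the bottom. *)
Definition side121 : diagram 3 2 :=
  if move_dir M is LeftToRight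
  then [tuple cross_at s1; cross_at s2; trace_at s1]
  else [tuple trace_at s1; cross_at s2; cross_at s1].

Definition side212 : diagram 3 2 :=
  if move_dir M is LeftToRight
  then [tuple trace_at s2; cross_at s1; cross_at s2]
  else [tuple cross_at s2; cross_at s1; trace_at s2].

Variables (X : Type) (Q : biquandle X).

Section MoveColors.
Variable c : 'I_4 -> 'I_3 -> X.

Definition trace_colors121 : X * X :=
  site_colors side121 c (if move_dir M is LeftToRight then ord_max else ord0).

Definition leftmost_color121 : X :=
  c (if move_dir M is LeftToRight then ord0 else ord_max) ord0.

Definition has_move_colors (x y z : X) : Prop :=
  match move_passage M with
  | Over => trace_colors121 = (x, y) /\ leftmost_color121 = z
  | Under => trace_colors121 = (y, z) /\ leftmost_color121 = x
  end.

End MoveColors.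

(* The colors (x, y, z) determine the colorings of both sides, so that the
   quantification over c and c' concerns exactly one pair. *)
Definition compatible (R : comPzRingType) (K : bracket Q R) (x y z : X) : Prop :=
  forall c c' : 'I_4 -> 'I_3 -> X,
    coloring Q side121 c -> coloring Q side212 c' ->
    (forall j, c ord0 j = c' ord0 j) ->
    (forall j, c ord_max j = c' ord_max j) ->
    has_move_colors c x y z ->
    forall kappa, total_coef K side121 c kappa = total_coef K side212 c' kappa.

End Moves.

(* Main.v *)
Require Import Defs.
From mathcomp Require Import all_boot all_algebra ring.

(* Smoothing the two crossings on S turns both sides into combinations of
   Temperley-Lieb monomials on three strands, with generators U1 and U2.  For a
   trace of type A the sides are the products (f1 A + f1 B U1)(f2 A + f2 B U2) and
   (g1 A + g1 B U1)(g2 A + g2 B U2), hence all their coefficients must agree.  For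
   a trace of type B they are further multiplied by U1 and U2 respectively, on
   opposite ends; then the coefficients of U1 and U2 must vanish, which, by the
   value of delta, means f1 A f2 B = f1 B f2 A and g1 A g2 B = g1 B g2 A, and those
   of the monomial of length 2 must agree.  Negative crossings replace all
   coefficients by their inverses, which does not affect such equations.  The
   axiom of the bracket with four terms relates the two sets of conditions. *)

Set Implicit Arguments.
Unset Strict Implicit.
Unset Printing Implicit Defensive.

Import GRing.Theory.
Local Open Scope ring_scope.

(** * Connectivities and loops of the states, by evaluation *)

Lemma exists_ord3 (P : pred 'I_3) :
  [exists l, P l] = [|| P (inord 0), P (inord 1) | P (inord 2)].
Proof.
apply/existsP/or3P=> [[[[|[|[|//]]] lt3]] | [] Pl]; [| | | by eexists; apply: Pl..];
  move=> Pl; [apply: Or31 | apply: Or32 | apply: Or33];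
  congr (is_true (P _)): Pl; apply/val_inj; by rewrite /= inordK.
Qed.

(* A state of the side of shape s1 s2 s1 ([b = true]) or s2 s1 s2 ([b = false]),
   as a list of positions and smoothings.  Points are pairs (level, position) of
   natural numbers, so that the connectivities of the 16 states can be found by
   computation. *)
Definition state_word (b : bool) (t0 t1 t2 : smoothing) : seq (nat * smoothing) :=
  zip (if b then [:: 0; 1; 0] else [:: 1; 0; 1])%N [:: t0; t1; t2].

Definition word_joined (w : seq (nat * smoothing)) (u v : nat * nat) : bool :=
  has (fun l => let: (i, t) := nth (0, TypeA)%N w l in
    let vertical u v := [&& u.1 == l, v.1 == l.+1, u.2 == v.2
      & (t == TypeA) || ((u.2 != i) && (u.2 != i.+1))] in
    let turning u v := [&& t == TypeB, u.2 == i, v.2 == i.+1, u.1 == v.1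
      & (u.1 == l) || (u.1 == l.+1)] in
    [|| vertical u v, vertical v u, turning u v | turning v u]) (iota 0 3).

Definition nat_points : seq (nat * nat) :=
  [seq (l, j) | l <- iota 0 4, j <- iota 0 3].

Definition reach (w : seq (nat * smoothing)) (k : nat) (u : nat * nat) :=
  iter k
    (fun r => [seq v <- nat_points | (v \in r) || has (word_joined w ^~ v) r])
    [:: u].

(* Locked, so that unification does not start evaluating it. *)
Fact component_key : unit. Proof. exact: tt. Qed.
(* 7 steps suffice, by [component_closed]. *)
Definition component : seq (nat * smoothing) -> nat * nat -> seq (nat * nat) :=
  locked_with component_key (reach^~ 7%N).

Lemma componentE : component = reach^~ 7%N.
Proof. by rewrite /component unlock. Qed.

(** Closure under adjacency certifies that the iteration has exhausted the component; evaluation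
    covers the 16 words. *)
Lemma component_closed (b : bool) (t0 t1 t2 : smoothing) :
  let w := state_word b t0 t1 t2 in
  all (fun u => let r := component w u in (u \in r) &&
    all (fun x => all (fun v => word_joined w x v ==> (v \in r)) nat_points) r)
    nat_points.
Proof. by rewrite componentE; case: b t0 t1 t2 => [] [] [] []; vm_compute. Qed.

Definition nat_ends : seq (nat * nat) := [seq (l, j) | l <- [:: 0; 3]%N, j <- iota 0 3].

Definition end_components w := flatten [seq component w e | e <- nat_ends].

(* The only state with a closed loop consists of two turnbacks at the same
   position around a vertical pair of strands; its loop goes through the
   middle levels. *)
Lemma no_end_loop (b : bool) (t0 t1 t2 : smoothing) :
  let w := state_word b t0 t1 t2 in
  let r := end_components w in
  if (t0, t1, t2) == (TypeB, TypeA, TypeB)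
  then let r1 := component w (1, 1)%N in
    all (fun v => (v \notin r) == (v \in r1)) nat_points
  else all (mem r) nat_points.
Proof.
by rewrite /end_components componentE; case: b t0 t1 t2 => [] [] [] []; vm_compute.
Qed.

Definition nat_point (u : point 3 2) : nat * nat := (val u.1, val u.2).

Lemma nat_point_inj : injective nat_point.
Proof. by move=> [u1 u2] [v1 v2] [/val_inj-> /val_inj->]. Qed.

Lemma nat_pointP (v : nat * nat) :
  reflect (exists u, v = nat_point u) (v \in nat_points).
Proof.
apply: (iffP allpairsP) => [[[l j] [lP jP ->]] | [[l j] ->]].
  exists (inord l, inord j); move: lP jP; rewrite !mem_iota /= => lP jP.
  by rewrite /nat_point /= !inordK.
by exists (val l, val j); split; rewrite // mem_iota /= ltn_ord.
Qed.

Definition nat_end (e : endpoint 2) : nat * nat := (if e.1 then 3 else 0, val e.2)%N.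

Lemma nat_endP (v : nat * nat) :
  reflect (exists e, v = nat_end e) (v \in nat_ends).
Proof.
apply: (iffP allpairsP) => [[[l j] [lP jP ->]] | [[l j] ->]].
  exists (l != 0, inord j)%N; rewrite /nat_end /= inordK.
    by move: lP; rewrite !inE /= => /orP[] /eqP->.
  by move: jP; rewrite mem_iota.
by exists (nat_end (l, j)); split; rewrite ?mem_iota /= ?ltn_ord //; case: l.
Qed.

Section States.

Variables (b : bool) (d0 d1 d2 : site 2) (t0 t1 t2 : smoothing).

Definition state3 : state 3 := [ffun l => tnth [tuple t0; t1; t2] l].

Let w := state_word b t0 t1 t2.
Let D : diagram 3 2 := [tuple d0; d1; d2].

Hypothesis posD :
  [seq val (site_pos d) | d <- [:: d0; d1; d2]]
  = if b then [:: 0; 1; 0]%N else [:: 1; 0; 1]%N.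

Lemma joined_word u v :
  joined D state3 u v = word_joined w (nat_point u) (nat_point v).
Proof.
rewrite /joined exists_ord3 /vertical_arc /turning_arc !ffunE.
rewrite !(tnth_nth d0) !(tnth_nth TypeA) /w /state_word -posD.
by rewrite /word_joined /= -!val_eqE /= /bump /= !inordK //= !add1n !orbF.
Qed.

Lemma joined_sym : symmetric (joined D state3).
Proof.
move=> u v; apply: eq_existsb => l.
rewrite orbCA; congr (_ || (_ || _)); exact: orbC.
Qed.

Lemma connect_joined_sym : connect_sym (joined D state3).
Proof. exact/sym_connect_sym/joined_sym. Qed.

Lemma reach_connect k u v :
  nat_point v \in reach w k (nat_point u) -> connect (joined D state3) u v.
Proof.
elim: k v => [|k IHk] v.
  by rewrite inE => /eqP/nat_point_inj->; apply: connect0.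
rewrite /reach iterS mem_filter -/(reach w k _).
case/andP=> /orP[/IHk // | /hasP[x xr xv]] _.
have /nat_pointP [x' Ex] : x \in nat_points.
  case: k xr {IHk} => [|k]; last by rewrite /reach iterS mem_filter => /andP[].
  by rewrite inE => /eqP->; apply/nat_pointP; exists u.
move: xr xv; rewrite Ex -joined_word => /IHk ux xv.
exact: connect_trans ux (connect1 xv).
Qed.

(** A path cannot leave a set closed under [word_joined]; conversely [reach] adds only connected
    points. *)
Lemma connect_component u v :
  connect (joined D state3) u v = (nat_point v \in component w (nat_point u)).
Proof.
apply/idP/idP => [|]; last by rewrite componentE; apply: reach_connect.
have /nat_pointP uP : exists u', nat_point u = nat_point u' by exists u.
have /allP/(_ _ uP)/andP[uu /allP cl] := component_closed b t0 t1 t2.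
case/connectP => p pP ->{v}; elim/last_ind: p pP => [|p x IHp] //=.
rewrite rcons_path last_rcons joined_word => /andP[/IHp/cl/allP px].
by apply/implyP/px/nat_pointP; exists x.
Qed.

Lemma nat_point_end e : nat_point (endpoint_point 3 e) = nat_end e.
Proof. by case: e => [[] j]. Qed.

Definition word_connectivity : {set endpoint 2 * endpoint 2} :=
  [set p | nat_end p.2 \in component w (nat_end p.1)].

Lemma in_word_connectivity p :
  (p \in word_connectivity) = (nat_end p.2 \in component w (nat_end p.1)).
Proof. by rewrite inE. Qed.

Lemma connectivity_word : connectivity D state3 = word_connectivity.
Proof.
by apply/setP=> p; rewrite in_word_connectivity inE connect_component !nat_point_end.
Qed.

(** By [no_end_loop], the points off the arcs through endpoints form the component of (1, 1) or the
    empty set. *)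
Lemma loops_word :
  loops D state3 = ((t0, t1, t2) == (TypeB, TypeA, TypeB)).
Proof.
rewrite /loops.
have EP :
  [pred v | [forall e, ~~ connect (joined D state3) (endpoint_point 3 e) v]] =i
  [pred v | nat_point v \notin end_components w].
  move=> v; rewrite [LHS]inE [RHS]inE; apply/forallP/idP => [nc | nv e].
    apply/flattenP => -[_ /mapP[_ /nat_endP[e ->] ->] ve].
    by have := nc e; rewrite connect_component nat_point_end ve.
  rewrite connect_component nat_point_end; apply: contra nv => ve.
  apply/flattenP; exists (component w (nat_end e)) => //.
  by apply: map_f; apply/nat_endP; exists e.
rewrite (eq_n_comp_r EP) {EP}; have := no_end_loop b t0 t1 t2; rewrite -/w.
have inP u : nat_point u \in nat_points by apply/nat_pointP; exists u.
case: eqP => _ /allP lP.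
  apply: etrans (n_comp_connect connect_joined_sym (inord 1, inord 1)).
  apply: eq_n_comp_r => v; rewrite [LHS]inE [RHS]inE (eqP (lP _ (inP v))).
  by rewrite connect_component /nat_point /= !inordK.
apply: eq_card0 => v; rewrite 2!inE [v \in _]inE.
by have /= -> := lP _ (inP v); rewrite andbF.
Qed.

End States.

(** * Connectivities as Temperley-Lieb monomials *)

(** The connectivity as a 6 by 6 Boolean matrix, comparable by evaluation. *)
Definition connectivity_table (w : seq (nat * smoothing)) : seq (seq bool) :=
  [seq let r := component w e in [seq f \in r | f <- nat_ends] | e <- nat_ends].

Lemma eq_word_connectivity_table b t0 t1 t2 b' t0' t1' t2' :
  (word_connectivity b t0 t1 t2 == word_connectivity b' t0' t1' t2')
  = (connectivity_table (state_word b t0 t1 t2)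
     == connectivity_table (state_word b' t0' t1' t2')).
Proof.
apply/eqP/eqP => [/setP E | /eq_in_map E].
  apply/eq_in_map => _ /nat_endP[e ->]; apply/eq_in_map => _ /nat_endP[f ->].
  have := @in_word_connectivity b t0 t1 t2 (e, f); rewrite E => <-.
  exact: in_word_connectivity (e, f).
apply/setP=> -[e f]; apply: etrans (in_word_connectivity _ _ _ _ (e, f)) _.
apply: esym (etrans (in_word_connectivity _ _ _ _ (e, f)) _) => /=.
have /E/eq_in_map-> // : nat_end e \in nat_ends by apply/nat_endP; exists e.
by apply/nat_endP; exists f.
Qed.

(* The Temperley-Lieb monomial of a state, without its loop; [false] and [true]
   stand for the generators at the first and at the second position. *)
Definition tl_monomial (b : bool) (t0 t1 t2 : smoothing) : seq bool :=
  match t0, t1, t2 with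
  | TypeA, TypeA, TypeA => [::]
  | TypeA, TypeB, TypeA => [:: b]
  | TypeB, TypeB, TypeA => [:: ~~ b; b]
  | TypeA, TypeB, TypeB => [:: b; ~~ b]
  | _, _, _ => [:: ~~ b]
  end.

Lemma eq_word_connectivity b t0 t1 t2 b' t0' t1' t2' :
  (word_connectivity b t0 t1 t2 == word_connectivity b' t0' t1' t2')
  = (tl_monomial b t0 t1 t2 == tl_monomial b' t0' t1' t2').
Proof.
rewrite eq_word_connectivity_table.
pose types := [:: TypeA; TypeB].
pose states := [seq (x, y) | x <- [seq (b, t0) | b <- [:: true; false], t0 <- types],
                             y <- [seq (t1, t2) | t1 <- types, t2 <- types]].
(* Each table is evaluated once, before all pairs of states of either shape are compared. *)
pose invariants x := let: (b, t0, (t1, t2)) := x in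
  (connectivity_table (state_word b t0 t1 t2), tl_monomial b t0 t1 t2).
pose agree r := all (fun p : seq (seq bool) * seq bool =>
  all (fun q => (p.1 == q.1) == (p.2 == q.2)) r) r.
have : agree (map invariants states).
  by rewrite /invariants /connectivity_table componentE; vm_compute.
have inS b1 u0 u1 u2 :
    invariants (b1, u0, (u1, u2)) \in map invariants states.
  by apply: map_f; case: b1 u0 u1 u2 => [] [] [] [].
move/allP/(_ _ (inS b t0 t1 t2))/allP/(_ _ (inS b' t0' t1' t2')) => {inS} /= /eqP.
exact.
Qed.

(** * State sums of diagrams with three sites *)

Lemma big_smoothing (R : nmodType) (F : smoothing -> R) :
  \sum_t F t = F TypeA + F TypeB.
Proof.
rewrite (reindex smoothing_of_bool) /=; first by rewrite big_bool.
by exists smoothing_to_bool => [[] | []].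
Qed.

Lemma big_state3 (R : nmodType) (F : state 3 -> R) :
  \sum_s F s = \sum_t0 \sum_t1 \sum_t2 F (state3 t0 t1 t2).
Proof.
rewrite pair_bigA pair_bigA /= (reindex (fun p => state3 p.1.1 p.1.2 p.2)) //=.
exists (fun s : state 3 => (s (inord 0), s (inord 1), s (inord 2)))
  => [[[t0 t1] t2] | s] _ /=.
  by rewrite !ffunE !(tnth_nth t0) /= !inordK.
apply/ffunP=> l; rewrite ffunE (tnth_nth TypeA) /=.
by case: l => [[|[|[|//]]] lt3] /=; congr (s _); apply/val_inj; rewrite /= inordK.
Qed.

Section Totals.

Variables (X : Type) (Q : biquandle X) (R : comPzRingType) (K : bracket Q R).

Definition weight (e : crossing_sign) (p : X * X) (t : smoothing) : R :=
  match e, t with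
  | Pos, TypeA => brA K p.1 p.2
  | Pos, TypeB => brB K p.1 p.2
  | Neg, TypeA => brAV K p.1 p.2
  | Neg, TypeB => brBV K p.1 p.2
  end.

Lemma skein_weightE m n (D : diagram m n) c l t :
  skein_weight K D c l t =
  if site_trace (tnth D l) is Some _ then 1
  else weight (site_sign (tnth D l)) (site_colors D c l) t.
Proof. by rewrite /skein_weight; case: (site_trace _). Qed.

Definition allowed (d : site 2) t := if site_trace d is Some t' then t == t' else true.

Lemma total_coef3 b (d0 d1 d2 : site 2) c kappa :
  let D : diagram 3 2 := [tuple d0; d1; d2] in
  [seq val (site_pos d) | d <- [:: d0; d1; d2]]
    = (if b then [:: 0; 1; 0]%N else [:: 1; 0; 1]%N) ->
  total_coef K D c kappa = \sum_t0 \sum_t1 \sum_t2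
    if [&& allowed d0 t0, allowed d1 t1, allowed d2 t2
         & word_connectivity b t0 t1 t2 == kappa]
    then skein_weight K D c (inord 0) t0 * skein_weight K D c (inord 1) t1
       * skein_weight K D c (inord 2) t2
       * brdelta K ^+ ((t0, t1, t2) == (TypeB, TypeA, TypeB))
    else 0.
Proof.
move=> D posD; rewrite /total_coef big_mkcond big_state3.
do 3![apply: eq_bigr => ? _].
rewrite (connectivity_word _ _ _ posD) (loops_word _ _ _ posD).
have forall_ord3 (P : pred 'I_3) :
    [forall l, P l] = [&& P (inord 0), P (inord 1) & P (inord 2)].
  by apply: negb_inj; rewrite negb_forall exists_ord3 !negb_and.
rewrite /expands forall_ord3 !ffunE !(tnth_nth d0) !(tnth_nth TypeA) /= !inordK //=.
rewrite !andbA; case: ifP => // _.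
congr (_ * _); rewrite !big_ord_recl big_ord0 mulr1 mulrA.
by rewrite !ffunE; congr (_ * _ * _); congr (skein_weight _ _ _ _ _);
  apply/val_inj; rewrite /= inordK.
Qed.

End Totals.

(** * Expansion of the two sides of a move *)

Section Expansion.

Variables (d : direction) (t : smoothing).

(* The connectivity when the crossings at positions 1 and 2 are smoothed to
   [a] and [b] and the trace has type [t]. *)
Definition connectivity121 (a b : smoothing) :=
  if d is LeftToRight then word_connectivity true a b t
  else word_connectivity true t b a.

Definition connectivity212 (a b : smoothing) :=
  if d is LeftToRight then word_connectivity false t a b
  else word_connectivity false b a t.

Section Sides.

Variables (X : Type) (Q : biquandle X) (R : comPzRingType) (K : bracket Q R).
Variables (p : passage) (e : crossing_sign) (c : 'I_4 -> 'I_3 -> X).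

Let M := Move p t e d.
Let w := weight K (moving_sign p d).

(** The level of the crossing at position 1; the one at position 2 is always at the middle level. On
    the other side the positions are exchanged. *)
Definition first121 : 'I_3 := if d is LeftToRight then inord 0 else inord 2.
Definition second212 : 'I_3 := if d is LeftToRight then inord 2 else inord 0.

(** Only the prescribed smoothing of the trace survives, with weight 1. The loop condition is
    invariant under reversal of the word, so it has one form for both directions. *)
Lemma total_coef121 kappa :
  total_coef K (side121 M) c kappa =
  \sum_a \sum_b w (site_colors (side121 M) c first121) a
    * w (site_colors (side121 M) c (inord 1)) b
    * brdelta K ^+ ((a, b, t) == (TypeB, TypeA, TypeB))
    *+ (connectivity121 a b == kappa).
Proof.
rewrite /M /w /side121 /first121 /connectivity121; case: d => /=;
  rewrite (@total_coef3 _ _ _ _ true) //.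
  do 2![apply: eq_bigr => ? _]; rewrite (bigD1 t) //= big1 ?addr0.
    rewrite /allowed /= eqxx !skein_weightE !(tnth_nth (Site ord0 e None)) /= !inordK //=.
    by rewrite mulr1; case: (_ == kappa).
  by move=> t' /negPf tF; rewrite /allowed /= tF.
rewrite (bigD1 t) //= [X in _ + X]big1 ?addr0; last first.
  by move=> t' /negPf tF; do 2![apply: big1 => ? _]; rewrite /allowed /= tF.
rewrite exchange_big; do 2![apply: eq_bigr => ? _].
rewrite /allowed /= eqxx !skein_weightE !(tnth_nth (Site ord0 e None)) /= !inordK //=.
rewrite mul1r; case: (_ == kappa) => //=.
rewrite [X in X * _ = _]mulrC; congr (_ * _ ^+ _).
by rewrite !xpair_eqE andbC andbA andbAC.
Qed.

Lemma total_coef212 kappa :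
  total_coef K (side212 M) c kappa =
  \sum_a \sum_b w (site_colors (side212 M) c (inord 1)) a
    * w (site_colors (side212 M) c second212) b
    * brdelta K ^+ ((b, a, t) == (TypeB, TypeA, TypeB))
    *+ (connectivity212 a b == kappa).
Proof.
rewrite /M /w /side212 /second212 /connectivity212; case: d => /=;
  rewrite (@total_coef3 _ _ _ _ false) //; last first.
  rewrite [RHS]exchange_big.
  do 2![apply: eq_bigr => ? _]; rewrite (bigD1 t) //= big1 ?addr0.
    rewrite /allowed /= eqxx !skein_weightE !(tnth_nth (Site ord0 e None)) /= !inordK //=.
    rewrite mulr1; case: (_ == kappa) => //=.
    by rewrite [X in X * _ = _]mulrC.
  by move=> t' /negPf tF; rewrite /allowed /= tF.
rewrite (bigD1 t) //= [X in _ + X]big1 ?addr0; last first.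
  by move=> t' /negPf tF; do 2![apply: big1 => ? _]; rewrite /allowed /= tF.
do 2![apply: eq_bigr => ? _].
rewrite /allowed /= eqxx !skein_weightE !(tnth_nth (Site ord0 e None)) /= !inordK //=.
rewrite mul1r; case: (_ == kappa) => //=.
congr (_ * _ ^+ _).
by rewrite !xpair_eqE andbC andbA andbAC.
Qed.

End Sides.

(* The coefficientwise equality of the two sides, where [f1], [f2] ([g1], [g2]) are
   the weights of the crossings at the positions 1 and 2 of the side of shape
   s1 s2 s1 (s2 s1 s2). *)
Definition skein_eqs (R : comPzRingType) (delta : R)
    (f1 f2 g1 g2 : smoothing -> R) : Prop :=
  if t is TypeA then forall a b, f1 a * f2 b = g1 a * g2 b
  else [/\ f1 TypeA * f2 TypeA + delta * (f1 TypeB * f2 TypeA)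
             + f1 TypeB * f2 TypeB = 0,
           g2 TypeA * g1 TypeA + delta * (g2 TypeB * g1 TypeA)
             + g2 TypeB * g1 TypeB = 0
         & f1 TypeA * f2 TypeB = g1 TypeB * g2 TypeA].

End Expansion.

Lemma eq_expansions d t (R : comPzRingType) (delta : R)
    (f1 f2 g1 g2 : smoothing -> R) :
  (forall kappa,
     \sum_a \sum_b f1 a * f2 b * delta ^+ ((a, b, t) == (TypeB, TypeA, TypeB))
        *+ (connectivity121 d t a b == kappa) =
     \sum_a \sum_b g1 a * g2 b * delta ^+ ((b, a, t) == (TypeB, TypeA, TypeB))
        *+ (connectivity212 d t a b == kappa)) <->
  skein_eqs t delta f1 f2 g1 g2.
Proof.
rewrite /skein_eqs; split=> E.
  case: t E => E.
    (* The four connectivities are distinct, so each one isolates a single coefficient on either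
       side. *)
    move=> a b; have := E (connectivity121 d TypeA a b); move: a b {E}.
    rewrite /connectivity121 /connectivity212 => [] [] []; rewrite !big_smoothing /=;
    by case: d; rewrite !eq_word_connectivity /= ?(mulr0n, mulr1n, addr0, add0r, mulr1).
  split.
  - have := E (connectivity121 d TypeB TypeB TypeA).
    rewrite /connectivity121 /connectivity212 !big_smoothing {E} /=.
    by case: d; rewrite !eq_word_connectivity /=;
      rewrite !(mulr0n, mulr1n, addr0, add0r, mulr1) => <-; ring.
  - have := E (connectivity212 d TypeB TypeA TypeB).
    rewrite /connectivity121 /connectivity212 !big_smoothing {E} /=.
    by case: d; rewrite !eq_word_connectivity /=;
      rewrite !(mulr0n, mulr1n, addr0, add0r, mulr1) => ->; ring.
  have := E (connectivity121 d TypeB TypeA TypeB).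
  rewrite /connectivity121 /connectivity212 !big_smoothing {E} /=.
  by case: d; rewrite !eq_word_connectivity /= !(mulr0n, mulr1n, addr0, add0r, mulr1).
move=> kappa; case: t E => E.
  apply: eq_bigr => a _; apply: eq_bigr => b _.
  rewrite E !xpair_eqE !andbF; congr (_ *+ (_ == _)); apply/eqP.
  rewrite /connectivity121 /connectivity212.
  by case: d a b => [] [] []; rewrite !eq_word_connectivity /=.
case: E => E1 E2 E3; rewrite !big_smoothing /= !(expr0, expr1, mulr1) E3.
(* Three states have the connectivity of U1; the fourth gives the monomial of length 2 shared with
   the other side. *)
have [-> -> ->] :
  [/\ connectivity121 d TypeB TypeB TypeA = connectivity121 d TypeB TypeA TypeA,
    connectivity121 d TypeB TypeB TypeB = connectivity121 d TypeB TypeA TypeA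
  & connectivity121 d TypeB TypeA TypeB = connectivity212 d TypeB TypeB TypeA].
  split; apply/eqP; rewrite /connectivity121 /connectivity212;
  by case: d; rewrite !eq_word_connectivity /=.
have [-> ->] : connectivity212 d TypeB TypeA TypeB = connectivity212 d TypeB TypeA TypeA
    /\ connectivity212 d TypeB TypeB TypeB = connectivity212 d TypeB TypeA TypeA.
  split; apply/eqP; rewrite /connectivity212; by case: d; rewrite !eq_word_connectivity /=.
(* Both sides reduce to the shared term, since [E1] and [E2] cancel the generators. *)
transitivity ((g1 TypeB * g2 TypeA) *+ (connectivity212 d TypeB TypeB TypeA == kappa)).
  rewrite -[RHS]add0r -(mul0rn _ (connectivity121 d TypeB TypeA TypeA == kappa)) -E1.
  by do 2!case: (_ == kappa); rewrite !(mulr1n, mulr0n); ring.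
rewrite -[LHS]add0r -(mul0rn _ (connectivity212 d TypeB TypeA TypeA == kappa)) -E2.
by do 2!case: (_ == kappa); rewrite !(mulr1n, mulr0n); ring.
Qed.

(** * Equations between units *)

Section Algebra.

Variable R : comPzRingType.
Implicit Types a b c d x y : R.

Lemma mul_unitI u v x y : u * v = 1 -> u * x = u * y -> x = y.
Proof.
by move=> uv1 /(congr1 ( *%R v)); rewrite !mulrA ![v * u]mulrC uv1 !mul1r.
Qed.

Lemma eq_inverse x x' y y' : x * x' = 1 -> y * y' = 1 -> x = y <-> x' = y'.
Proof.
move=> xx yy; split=> E.
  by apply: (mul_unitI xx); rewrite xx E yy.
by apply: (@mul_unitI x' x); rewrite 1?mulrC // xx E mulrC yy.
Qed.

Lemma mul_inverse x x' y y' :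
  x * x' = 1 -> y * y' = 1 -> (x * y) * (x' * y') = 1.
Proof. by move=> xx yy; rewrite mulrACA xx yy mulr1. Qed.

(** For this value of [delta] the left-hand side is the unit [a' * b] times [a * d - b * c]. *)
Lemma loop_eq0 delta a b a' b' c d :
    a * a' = 1 -> b * b' = 1 -> delta = - (a' * b) - a * b' ->
  a * c + delta * (b * c) + b * d = 0 <-> a * d = b * c.
Proof.
move=> aa bb ->.
have -> : a * c + (- (a' * b) - a * b') * (b * c) + b * d
   = a' * b * (a * d - b * c).
  (* This is the discrepancy between the two sides before [aa] and [bb] are used. *)
  have : a * (1 - b * b') * c + b * d * (1 - a * a') = 0
    by rewrite aa bb subrr mulr0 mul0r mulr0 addr0.
  by move=> E; rewrite -[RHS]addr0 -E; ring.
split=> [E|->]; last by rewrite subrr mulr0.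
apply/subr0_eq/(@mul_unitI (a' * b) (a * b')); last by rewrite mulr0.
by apply: mul_inverse => //; rewrite mulrC.
Qed.

End Algebra.

(** * From skein equations to the conditions of the theorem *)

Section Brackets.

Variables (X : Type) (Q : biquandle X) (R : comPzRingType) (K : bracket Q R).

Definition opposite (e : crossing_sign) := if e is Pos then Neg else Pos.

Lemma weight_unit e u t : weight K e u t * weight K (opposite e) u t = 1.
Proof.
by case: e t => [] []; rewrite /= ?brA_unit ?brB_unit // mulrC ?brA_unit ?brB_unit.
Qed.

Lemma weight_delta e u :
  brdelta K = - (weight K (opposite e) u TypeA * weight K e u TypeB)
              - weight K e u TypeA * weight K (opposite e) u TypeB.
Proof. by case: e => /=; rewrite -(bracket_delta K u.1 u.2) //; ring. Qed.

Lemma eq_weight e u1 u2 v1 v2 t1 t2 s1 s2 :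
  weight K e u1 t1 * weight K e u2 t2 = weight K e v1 s1 * weight K e v2 s2 <->
  weight K Pos u1 t1 * weight K Pos u2 t2 = weight K Pos v1 s1 * weight K Pos v2 s2.
Proof.
case: e => //; symmetry.
by apply: eq_inverse; apply: mul_inverse; apply: (@weight_unit Pos).
Qed.

Definition mixed_eqs (f1 f2 g1 g2 : smoothing -> R) : Prop :=
  [/\ f1 TypeA * f2 TypeB = g1 TypeB * g2 TypeA,
      g1 TypeB * g2 TypeA = g1 TypeA * g2 TypeB
    & g1 TypeA * g2 TypeB = f1 TypeB * f2 TypeA].

Lemma skein_eqs_weight t e u1 u2 v1 v2 :
  skein_eqs t (brdelta K) (weight K e u1) (weight K e u2)
              (weight K e v1) (weight K e v2) <->
  let w := weight K Pos in
  if t is TypeA then forall a b, w u1 a * w u2 b = w v1 a * w v2 b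
  else mixed_eqs (w u1) (w u2) (w v1) (w v2).
Proof.
case: t => /=.
  by split=> E a b; move: (E a b) => /eq_weight.
have loopE u v := @loop_eq0 _ (brdelta K) (weight K e u TypeA) (weight K e u TypeB) _ _
  (weight K e v TypeA) (weight K e v TypeB) (weight_unit e u TypeA)
  (weight_unit e u TypeB) (weight_delta e u).
split=> [[/loopE/eq_weight E1 /loopE E2 /eq_weight E3] | [E1 E2 E3]].
  have {}E2 : weight K e v1 TypeB * weight K e v2 TypeA
            = weight K e v1 TypeA * weight K e v2 TypeB.
    by rewrite mulrC E2 mulrC.
  by move/eq_weight: E2 => E2; split; rewrite -?E2 -?E3.
split; last exact/eq_weight.
  by apply/loopE/eq_weight; rewrite E1 E2 E3.
by apply/loopE; rewrite mulrC [RHS]mulrC; apply/eq_weight.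
Qed.

Section Conditions.

Variables (a a' b' : X * X) (u1 u2 v1 v2 : X * X).

Let w := weight K Pos.

(** Three bracket axioms with the weight of the trace pulled out: [a] and [a'] are its colors, [u1],
    [u2] and [v1], [v2] those of the crossings on S. In [eqAB] the terms with the trace smoothed by
    B are collected into the expression of [loop_eq0]. *)
Hypothesis eqAA : w a TypeA * (w u1 TypeA * w u2 TypeA)
  = w a' TypeA * (w v1 TypeA * w v2 TypeA).
Hypothesis eqBB : w a TypeA * (w u1 TypeB * w u2 TypeB)
  = w a' TypeA * (w v1 TypeB * w v2 TypeB).
Hypothesis eqAB : w a TypeA * (w u1 TypeA * w u2 TypeB)
  = w a' TypeA * (w v1 TypeA * w v2 TypeB)
    + w b' TypeB * (w v2 TypeA * w v1 TypeA
        + brdelta K * (w v2 TypeB * w v1 TypeA) + w v2 TypeB * w v1 TypeB).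

Let unit2 u v s t : w u s * w v t * (weight K Neg u s * weight K Neg v t) = 1.
Proof. by apply: mul_inverse; apply: (@weight_unit Pos). Qed.

Let loopE := loop_eq0 (w v1 TypeA) (w v1 TypeB) (weight_unit Pos v2 TypeA)
  (weight_unit Pos v2 TypeB) (weight_delta Pos v2).

(** The chain makes the collected expression in [eqAB] vanish; cancelling the common unit leaves the
    equality of the trace weights. *)
Lemma mixed_eqsP :
  mixed_eqs (w u1) (w u2) (w v1) (w v2) <->
  w a TypeA = w a' TypeA /\ mixed_eqs (w u1) (w u2) (w v1) (w v2).
Proof.
split=> [E|[]//]; split=> //; case: E => E1 E2 E3.
apply: (mul_unitI (unit2 u1 u2 TypeA TypeB)).
rewrite mulrC eqAB (_ : _ + _ + _ = 0) ?mulr0 ?addr0.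
  by rewrite E1 E2 mulrC.
by apply/loopE; rewrite mulrC E2 mulrC.
Qed.

(** Forwards, [eqAA] equates the trace weights, and then [eqAB] forces the collected expression to
    vanish. Backwards, the pure products come from [eqAA] and [eqBB], the mixed ones from the
    chain. *)
Lemma parallel_eqsP :
  (forall s t, w u1 s * w u2 t = w v1 s * w v2 t) <->
  w a TypeA = w a' TypeA /\ mixed_eqs (w u1) (w u2) (w v1) (w v2).
Proof.
split=> [E | [aa' [E1 E2 E3]]].
  have aa' : w a TypeA = w a' TypeA.
    apply: (mul_unitI (unit2 v1 v2 TypeA TypeA)).
    by rewrite mulrC -E eqAA E mulrC.
  split=> //.
  have /loopE L : w v2 TypeA * w v1 TypeA + brdelta K * (w v2 TypeB * w v1 TypeA)
      + w v2 TypeB * w v1 TypeB = 0.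
    apply: (mul_unitI (weight_unit Pos b' TypeB)); rewrite mulr0.
    by move: eqAB; rewrite aa' E -[LHS]addr0 => /addrI.
  have L' : w v1 TypeB * w v2 TypeA = w v1 TypeA * w v2 TypeB.
    by rewrite mulrC L mulrC.
  by split; rewrite ?E ?L'.
have U := weight_unit Pos a TypeA.
case=> [] [].
- by apply: (mul_unitI U); rewrite -/(w _ _) eqAA aa'.
- by rewrite E1 E2.
- by rewrite -E3 -E2.
- by apply: (mul_unitI U); rewrite -/(w _ _) eqBB aa'.
Qed.

Lemma skein_conditionsP t :
  (if t is TypeA then forall s s', w u1 s * w u2 s' = w v1 s * w v2 s'
   else mixed_eqs (w u1) (w u2) (w v1) (w v2)) <->
  w a TypeA = w a' TypeA /\ mixed_eqs (w u1) (w u2) (w v1) (w v2).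
Proof. by case: t; [exact: parallel_eqsP | exact: mixed_eqsP]. Qed.

End Conditions.

End Brackets.

(** * Colorings of the two sides *)

Section MoveColorings.

Variables (X : Type) (Q : biquandle X) (x y z : X).

(* The pairs of colors on the left and on the right of the bracket axioms, the
   pair of the trace being left out. *)
Definition lhs_colors (p : passage) : (X * X) * (X * X) :=
  (if p is Over then (y, z) else (x, y), (up Q x y, dn Q z y)).

Definition rhs_colors (p : passage) : (X * X) * (X * X) :=
  ((x, z), if p is Over then (dn Q y x, dn Q z x) else (up Q x z, up Q y z)).

(* Whether the side of shape s1 s2 s1 corresponds to the left-hand sides of the
   bracket axioms. *)
Definition lhs_on_121 (M : move) : bool :=
  match move_passage M, move_sign M, move_dir M with
  | Over, Pos, LeftToRight | Over, Neg, RightToLeft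
  | Under, Neg, LeftToRight | Under, Pos, RightToLeft => true
  | _, _, _ => false
  end.

(** One equation for the strand avoiding the site replaces a quantified condition, as [congruence]
    requires. *)
Lemma site_colored_third m (D : diagram m 2) (c : 'I_m.+1 -> 'I_3 -> X) l :
  let third := if site_pos (tnth D l) == ord0 then ord_max else ord0 in
  site_colored Q D c l ->
  [/\ under_right D c l = up Q (under_left D c l) (over_left D c l),
      over_right D c l = dn Q (over_left D c l) (under_left D c l)
    & c (lo l) third = c (hi l) third].
Proof.
move=> third [Eu Eo E3]; split=> //; apply: E3; rewrite /third;
by case: (site_pos _) => -[|[|//]].
Qed.

(** The colors needed follow from the given ones by applying the operations from left to right, so
    congruence closure suffices. *)
Lemma move_site_colors (M : move) (c c' : 'I_4 -> 'I_3 -> X) :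
  coloring Q (side121 M) c -> coloring Q (side212 M) c' ->
  (forall j, c ord0 j = c' ord0 j) -> (forall j, c ord_max j = c' ord_max j) ->
  has_move_colors M c x y z ->
  (site_colors (side121 M) c (first121 (move_dir M)),
   site_colors (side121 M) c (inord 1)) =
  (if lhs_on_121 M then lhs_colors else rhs_colors) (move_passage M) /\
  (site_colors (side212 M) c' (inord 1),
   site_colors (side212 M) c' (second212 (move_dir M))) =
  (if lhs_on_121 M then rhs_colors else lhs_colors) (move_passage M).
Proof.
have -> : inord 1 = @Ordinal 3 1 isT by apply/val_inj; rewrite /= inordK.
have i0 : inord 0 = @Ordinal 3 0 isT by apply/val_inj; rewrite /= inordK.
have i2 : inord 2 = @Ordinal 3 2 isT by apply/val_inj; rewrite /= inordK.
rewrite /first121 /second212 i0 i2 {i0 i2}.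
(* Indexing by natural numbers gives equal points syntactically equal names. *)
have natE (a : 'I_4 -> 'I_3 -> X) l j : a l j = a (inord l) (inord j).
  by rewrite !inord_val.
pose C n m := c (inord n) (inord m).
pose C' n m := c' (inord n) (inord m).
have cE l j : c l j = C l j by exact: natE.
have c'E l j : c' l j = C' l j by exact: natE.
move=> col col' bot top.
have {}col l := site_colored_third (col l).
have {}col' l := site_colored_third (col' l).
move: (col (@Ordinal 3 0 isT)) (col (@Ordinal 3 1 isT)) (col (@Ordinal 3 2 isT)).
move: (col' (@Ordinal 3 0 isT)) (col' (@Ordinal 3 1 isT)) (col' (@Ordinal 3 2 isT)).
move: (bot (@Ordinal 3 0 isT)) (bot (@Ordinal 3 1 isT)).
move: (top (@Ordinal 3 0 isT)) (top (@Ordinal 3 1 isT)).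
move=> {col col' bot top}.
rewrite /has_move_colors /trace_colors121 /leftmost_color121 /lhs_colors /rhs_colors.
case: M => p t e d /=.
rewrite /site_colors /under_left /over_left /under_right /over_right.
clear -cE c'E.
case: p; case: e; case: d => /=; rewrite !(cE, c'E) /= /bump /= !add1n {cE c'E};
  clearbody C C'; move=> ? ? ? ?; do 6!case=> ? ? ?; move=> [[? ?] ?];
  by split; congruence.
Qed.

(** The colors of the rightmost edges of the strands; biquandle axiom (iii) gives each a second
    expression. *)
Let cx := up Q (up Q x y) (dn Q z y).
Let cz := dn Q (dn Q z y) (up Q x y).
Let cy := dn Q (up Q y z) (up Q x z).

(* The colors of a level in which the three strands, named by the colors of their
   leftmost edges, come in the indicated order.  Each side of a move runs through
   one half of the hexagon formed by the six orders. *)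
Let zyx := [:: z; up Q y z; cx].
Let yzx := [:: y; dn Q z y; cx].
Let yxz := [:: y; up Q x y; cz].
Let xyz := [:: x; dn Q y x; cz].
Let xzy := [:: x; dn Q z x; cy].
Let zxy := [:: z; up Q x z; cy].

Definition levels121 (M : move) : seq (seq X) :=
  let levels := match move_passage M, lhs_on_121 M with
    | Over, true => [:: zyx; yzx; yxz; xyz]
    | Over, false => [:: zxy; xzy; xyz; yxz]
    | Under, false => [:: xzy; zxy; zyx; yzx]
    | Under, true => [:: xyz; yxz; yzx; zyx]
    end in
  if move_dir M is LeftToRight then levels else rev levels.

Definition levels212 (M : move) : seq (seq X) :=
  let levels := match move_passage M, lhs_on_121 M with
    | Over, true => [:: zyx; zxy; xzy; xyz]
    | Over, false => [:: zxy; zyx; yzx; yxz]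
    | Under, false => [:: xzy; xyz; yxz; yzx]
    | Under, true => [:: xyz; xzy; zxy; zyx]
    end in
  if move_dir M is LeftToRight then levels else rev levels.

(** This keeps [compatible] from holding vacuously: by axiom (iii) the two halves of the hexagon
    close up. *)
Lemma move_coloring (M : move) :
  let c levels (l : 'I_4) (j : 'I_3) := nth x (nth [::] levels l) j in
  [/\ coloring Q (side121 M) (c (levels121 M)),
      coloring Q (side212 M) (c (levels212 M)),
      forall j, c (levels121 M) ord0 j = c (levels212 M) ord0 j,
      forall j, c (levels121 M) ord_max j = c (levels212 M) ord_max j
    & has_move_colors M (c (levels121 M)) x y z].
Proof.
have xE : up Q (up Q x z) (up Q y z) = cx by exact: up_up.
have zE : dn Q (dn Q z x) (dn Q y x) = cz by exact: dn_dn.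
have yE : up Q (dn Q y x) (dn Q z x) = cy by rewrite -dn_up.
move: (esym xE) (esym zE) (esym yE) => xE' zE' yE' c.
by case: M => -[] t [] []; split; (try case=> [[|[|[|//]]] lt3]); try by [];
  split=> //; case=> [[|[|[|//]]] lt3'].
Qed.

End MoveColorings.

(** * Compatibility in terms of the bracket axioms *)

Lemma mixed_eqs_sym (R : comPzRingType) (f1 f2 g1 g2 : smoothing -> R) :
  mixed_eqs f1 f2 g1 g2 <-> mixed_eqs g1 g2 f1 f2.
Proof. by split=> -[E1 E2 E3]; split; congruence. Qed.

Lemma eq_total_coef (X : Type) (Q : biquandle X) (R : comPzRingType)
    (K : bracket Q R) (M : move) (c c' : 'I_4 -> 'I_3 -> X) :
  let w := weight K (moving_sign (move_passage M) (move_dir M)) in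
  (forall kappa,
     total_coef K (side121 M) c kappa = total_coef K (side212 M) c' kappa) <->
  skein_eqs (move_type M) (brdelta K)
    (w (site_colors (side121 M) c (first121 (move_dir M))))
    (w (site_colors (side121 M) c (inord 1)))
    (w (site_colors (side212 M) c' (inord 1)))
    (w (site_colors (side212 M) c' (second212 (move_dir M)))).
Proof.
case: M => p t e d /=; split=> [E | /(eq_expansions d) E kappa].
  apply/(eq_expansions d) => kappa.
  by have := E kappa; rewrite total_coef121 total_coef212.
by have := E kappa; rewrite total_coef121 total_coef212.
Qed.

(** The sign of the trace and the direction of S affect only which side carries which colors and
    whether weights are inverted; the equations are insensitive to both. *)
Lemma compatibleP (X : Type) (Q : biquandle X) (R : comPzRingType)
    (K : bracket Q R) (M : move) (x y z : X) :
  let u := lhs_colors Q x y z (move_passage M) in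
  let v := rhs_colors Q x y z (move_passage M) in
  let w := weight K Pos in
  compatible M K x y z <->
  if move_type M is TypeA then forall s t, w u.1 s * w u.2 t = w v.1 s * w v.2 t
  else mixed_eqs (w u.1) (w u.2) (w v.1) (w v.2).
Proof.
move=> u v w.
set sigma := moving_sign (move_passage M) (move_dir M).
pose eqs u v := skein_eqs (move_type M) (brdelta K)
  (weight K sigma u.1) (weight K sigma u.2)
  (weight K sigma v.1) (weight K sigma v.2).
have totalP c c' u' v' :
    (site_colors (side121 M) c (first121 (move_dir M)),
     site_colors (side121 M) c (inord 1)) = u' ->
    (site_colors (side212 M) c' (inord 1),
     site_colors (side212 M) c' (second212 (move_dir M))) = v' ->
    (forall kappa, total_coef K (side121 M) c kappa
                   = total_coef K (side212 M) c' kappa) <-> eqs u' v'.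
  by move=> <- <-; apply: eq_total_coef.
transitivity (eqs (if lhs_on_121 M then u else v) (if lhs_on_121 M then v else u)).
  have swap (b : bool) : (if b then lhs_colors Q x y z else rhs_colors Q x y z)
      (move_passage M) = if b then u else v by case: b.
  have swap' (b : bool) : (if b then rhs_colors Q x y z else lhs_colors Q x y z)
      (move_passage M) = if b then v else u by case: b.
  split=> [cpt | E c c' col col' bot top colM].
    case: (move_coloring Q x y z M) => col col' bot top colM.
    have [E121 E212] := move_site_colors col col' bot top colM.
    by apply: iffLR (cpt _ _ col col' bot top colM); apply: totalP; rewrite ?E121 ?E212.
  have [E121 E212] := move_site_colors col col' bot top colM.
  by apply: iffRL E; apply: totalP; rewrite ?E121 ?E212.
rewrite /eqs; case: ifP => _; rewrite skein_eqs_weight; first exact: iff_refl.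
case: (move_type M) => /=; last exact: mixed_eqs_sym.
by split=> E s t; apply: esym; apply: E.
Qed.

Theorem theorem2 (X : finType) (Q : biquandle X) (R : comPzRingType)
    (K : bracket Q R) (x y z : X) :
  let A := brA K in
  let B := brB K in
  let up := up Q in
  let dn := dn Q in
  (forall (t : smoothing) (e : crossing_sign) (d : direction),
     compatible (Move Over t e d) K x y z <->
     A x y = A (up x z) (up y z) /\
     [/\ A y z * B (up x y) (dn z y) = B x z * A (dn y x) (dn z x),
         B x z * A (dn y x) (dn z x) = A x z * B (dn y x) (dn z x)
       & A x z * B (dn y x) (dn z x) = B y z * A (up x y) (dn z y)]) /\
  (forall (t : smoothing) (e : crossing_sign) (d : direction),
     compatible (Move Under t e d) K x y z <->
     A y z = A (dn y x) (dn z x) /\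
     [/\ A x y * B (up x y) (dn z y) = B x z * A (up x z) (up y z),
         B x z * A (up x z) (up y z) = A x z * B (up x z) (up y z)
       & A x z * B (up x z) (up y z) = B x y * A (up x y) (dn z y)]).
Proof.
move=> A B up' dn'; split=> t e d; apply: iff_trans (compatibleP _ _ _ _ _) _.
(* For an overcrossing the trace is the first factor on the left of the axioms and the third on the
   right. *)
- have AA : A x y * (A y z * A (up' x y) (dn' z y))
      = A (up' x z) (up' y z) * (A x z * A (dn' y x) (dn' z x)).
    by rewrite mulrA bracket_AAA mulrC.
  have BB : A x y * (B y z * B (up' x y) (dn' z y))
      = A (up' x z) (up' y z) * (B x z * B (dn' y x) (dn' z x)).
    by rewrite mulrA bracket_ABB mulrC.
  have AB : A x y * (A y z * B (up' x y) (dn' z y))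
      = A (up' x z) (up' y z) * (A x z * B (dn' y x) (dn' z x))
        + B (up' x z) (up' y z) * (A (dn' y x) (dn' z x) * A x z
          + brdelta K * (B (dn' y x) (dn' z x) * A x z)
          + B (dn' y x) (dn' z x) * B x z).
    by rewrite mulrA bracket_AAB /A /B /up' /dn'; ring.
  exact: (skein_conditionsP (a := (_, _)) (a' := (_, _)) (b' := (_, _))
    (u1 := (_, _)) (u2 := (_, _)) (v1 := (_, _)) (v2 := (_, _)) AA BB AB).
(* For an undercrossing it is the second factor on both sides, and [bracket_BAB] takes the place of
   [bracket_ABB]. *)
- have AA : A y z * (A x y * A (up' x y) (dn' z y))
      = A (dn' y x) (dn' z x) * (A x z * A (up' x z) (up' y z)).
    by rewrite mulrCA mulrA bracket_AAA /A /B /up' /dn'; ring.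
  have BB : A y z * (B x y * B (up' x y) (dn' z y))
      = A (dn' y x) (dn' z x) * (B x z * B (up' x z) (up' y z)).
    by rewrite mulrCA mulrA bracket_BAB /A /B /up' /dn'; ring.
  have AB : A y z * (A x y * B (up' x y) (dn' z y))
      = A (dn' y x) (dn' z x) * (A x z * B (up' x z) (up' y z))
        + B (dn' y x) (dn' z x) * (A (up' x z) (up' y z) * A x z
          + brdelta K * (B (up' x z) (up' y z) * A x z)
          + B (up' x z) (up' y z) * B x z).
    by rewrite mulrCA mulrA bracket_AAB /A /B /up' /dn'; ring.
  exact: (skein_conditionsP (a := (_, _)) (a' := (_, _)) (b' := (_, _))
    (u1 := (_, _)) (u2 := (_, _)) (v1 := (_, _)) (v2 := (_, _)) AA BB AB).
Qed.
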